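(* Let $n\geq3$ and $k\geq3$. Then there exists a $k$-ary orientable sequence of order $n+1$ with period at least $k\,s_k(n-1)$, where $s_k(n-1)$ is as defined in the context.
   Context: A $k$-ary sequence is a periodic sequence $S=(s_i)$ with entries in $\mathbb{Z}_k$; its period is the least positive $p$ with $s_{i+p}=s_i$ for all $i$. Write $\mathbf{s}_N(i)=(s_i,\dots,s_{i+N-1})$. $S$ is an $N$-window sequence if $\mathbf{s}_N(i)=\mathbf{s}_N(j)$ implies $i\equiv j\pmod p$. An orientable sequence of order $N$ is a $k$-ary $N$-window sequence with $\mathbf{s}_N(i)\neq\mathbf{s}_N(j)^R$ for all $i,j$, where $\mathbf{u}^R$ denotes the reverse of $\mathbf{u}$. Let $\delta=1$ if $k$ is odd and $\delta=2$ if $k$ is even, and write $n=2^tm$ with $m$ odd. Define $s_k(n-1)=\frac{k^n-\delta(n(k^{(n-1)/2}-1)+1)}{2}$ if $n$ is odd, and $s_k(n-1)=\frac{k^n - \frac{nk^{(n-2)/2}}{2}(\delta^2+k) +n\delta k^{(m-1)/2} - m\delta(k^{(m-1)/2}-1)-\delta}{2}$ if $n$ is even. *)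

(* Defs.v *)
From HB Require Import structures.
From mathcomp Require Import all_boot all_order all_algebra.

Set Implicit Arguments.
Unset Strict Implicit.
Unset Printing Implicit Defensive.

Import Order.TTheory GRing.Theory Num.Theory.

(* Periodic sequences are indexed by nat; 'Z_k is the integers mod k only for
   k >= 2. *)
Section Sequences.
Variable k : nat.
Implicit Types (s : nat -> 'Z_k) (N p i j : nat).

Definition is_period s p : Prop :=
  [/\ 0 < p,
      forall i, s (i + p) = s i
    & forall q, 0 < q -> (forall i, s (i + q) = s i) -> p <= q].

Definition window s N i : seq 'Z_k := [seq s (i + j) | j <- iota 0 N].

Definition window_sequence N s p : Prop :=
  is_period s p /\
  forall i j, window s N i = window s N j -> i = j %[mod p].

Definition orientable_sequence N s p : Prop :=
  window_sequence N s p /\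
  forall i j, window s N i <> rev (window s N j).

End Sequences.

Definition delta k : nat := if odd k then 1 else 2.

Definition odd_part n : nat := n %/ 2 ^ logn 2 n.

Local Open Scope ring_scope.

(* The formulas are written in terms of n = r + 1. They are rational-valued so
   that subtraction and division by 2 are exact; the halved exponents are
   exact divisions, by the parity of n and of m. *)
Definition s_ (k r : nat) : rat :=
  let n := r.+1 in
  let m := odd_part n in
  let K : rat := k%:R in
  let d : rat := (delta k)%:R in
  if odd n then
    (K ^+ n - d * (n%:R * (K ^+ ((n - 1) %/ 2) - 1) + 1)) / 2%:R
  else
    (K ^+ n - n%:R * K ^+ ((n - 2) %/ 2) / 2%:R * (d ^+ 2 + K)
       + n%:R * d * K ^+ ((m - 1) %/ 2)
       - m%:R * d * (K ^+ ((m - 1) %/ 2) - 1) - d) / 2%:R.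

(* Main.v *)
From mathcomp Require Import all_boot all_order all_fingroup all_algebra.
From mathcomp Require Import zify lra.
Require Import Defs.

Set Implicit Arguments.
Unset Strict Implicit.
Unset Printing Implicit Defensive.

Import Order.TTheory GRing.Theory Num.Theory.

(* A sequence is orientable of order n + 1 as soon as the n-tuples of its
   consecutive differences are taken from a set E that contains no word together
   with its negated reverse, and its windows of length n + 1 are distinct.
   Let E contain the words of weight less than half the maximum, where the
   letters 1, ..., k - 1 weigh their value and 0 weighs k / 2, and, among the
   words of exactly half weight, one of each pair of distinct rotation classes
   exchanged by negated reversal.  E is closed under rotation, so rotating the
   difference word permutes the windows over E; two cycles of such a permutation
   that share an n-tuple can be joined.  Everything gets joined into one cycle:
   replacing a letter by 1, the unique lightest one, keeps a word in E, so every
   window is linked to one with difference word 1...1, and the windows of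
   difference word 1...1 are linked with each other because 1 generates Z_k.
   The cycle has length k |E|, and E misses only the words whose rotation class
   is invariant under negated reversal.  These are the words fixed by one of n
   reflections, and a union bound, refined for the words whose period divides
   the odd part of n and for the constant words, gives s_k(n - 1). *)

(** * Joining the cycles of a permutation *)

(** Take a compatible permutation with the fewest cycles: if [x] and [y] shared a tail but not a
    cycle, exchanging their images would keep compatibility and merge the two cycles. *)
Lemma cycle_joining (T : finType) (V : eqType) (hd tl : T -> V)
    (s0 : {perm T}) :
  (forall x, tl x = hd (s0 x)) ->
  exists s : {perm T},
    [/\ forall x, tl x = hd (s x),
        forall x y, tl x = tl y -> porbit s x = porbit s y
      & forall x, porbit s (s0 x) = porbit s x].
Proof.
move=> hs0.
have P0 : [forall x, tl x == hd (s0 x)] by apply/forallP => x; apply/eqP.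
case: (@arg_minnP {perm T} s0 (fun s => [forall x, tl x == hd (s x)])
  (fun s : {perm T} => #|porbits s|) P0) => s /forallP hs mins.
have join x y : tl x = tl y -> porbit s x = porbit s y.
  move=> exy; apply/eqP; rewrite eq_porbit_mem.
  apply: contraT => xy.
  have := mins (tperm x y * s)%g; have := porbits_mul_tperm s x y.
  rewrite xy => e /(_ _) h.
  have nxy : x != y by apply: contraNneq xy => ->; rewrite porbit_id.
  have : #|porbits s| <= #|porbits (tperm x y * s)%g|.
    apply: h; apply/forallP => z; rewrite permM.
    case: tpermP => [->|->|_ _]; last exact: hs.
      by rewrite exy hs.
    by rewrite -exy hs.
  by rewrite nxy in e; lia.
exists s; split=> // x; first exact/eqP.
(* The preimage of [s0 x] under [s] has the same tail as [x]. *)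
have <- : porbit s (s^-1 (s0 x))%g = porbit s x.
  by apply: join; apply/eqP; rewrite (eqP (hs _)) permKV hs0.
by apply/eqP; rewrite eq_porbit_mem -{1}(permKV s (s0 x)) -{1}(expg1 s) mem_porbit.
Qed.

Lemma iter_full_porbit (T : finType) (s : {perm T}) (x : T) :
  (forall y, porbit s y = porbit s x) ->
  forall i j, (iter i s x == iter j s x) = (i == j %[mod #|T|]).
Proof.
move=> full i j.
have cT : #|porbit s x| = #|T|.
  by apply: eq_card => y; rewrite -eq_porbit_mem full eqxx.
have T0 : 0 < #|T| by apply/card_gt0P; exists x.
have red i' : iter i' s x = iter (i' %% #|T|) s x.
  rewrite {1}(divn_eq i' #|T|) addnC iterD; congr iter.
  elim: (i' %/ #|T|) => // q IH; rewrite mulSn iterD IH.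
  by rewrite -{1}cT iter_porbit.
rewrite (red i) (red j).
have hi := ltn_pmod i T0; have hj := ltn_pmod j T0.
rewrite -{1}(nth_traject s hi x) -{1}(nth_traject s hj x).
by rewrite nth_uniq ?size_traject // -cT uniq_traject_porbit.
Qed.

Local Open Scope ring_scope.

(** * Words fixed by a reflection *)

(** The value is free on one element of each two-element orbit of [phi], and is its own negative at
    a fixed point. *)
Lemma card_skew_ffun (I : finType) (A : finZmodType) (phi : I -> I) :
  involutive phi ->
  (#|[set u : {ffun I -> A} | [forall i, u (phi i) == - u i]]| =
   #|A| ^ ((#|I| - #|[set i | phi i == i]|) %/ 2)
     * #|[set x : A | - x == x]| ^ #|[set i | phi i == i]|)%N.
Proof.
move=> phiK.
pose J := [set i | (enum_rank i < enum_rank (phi i))%N].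
pose J' := [set i | (enum_rank (phi i) < enum_rank i)%N].
pose F0 := [set i | phi i == i].
have cJ : #|J'| = #|J|.
  rewrite -(card_imset _ (can_inj phiK)); apply: eq_card => i.
  rewrite inE; apply/imsetP/idP => [[j] + ->|h].
    by rewrite inE phiK.
  by exists (phi i); rewrite ?inE phiK.
have rk i : (nat_of_ord (enum_rank i) == enum_rank (phi i)) = (phi i == i).
  by rewrite [RHS]eq_sym -(inj_eq enum_rank_inj).
have cI : (#|I| = #|F0| + (#|J| + #|J|))%N.
  rewrite -{2}cJ -!sum1_card.
  rewrite ![in RHS](big_mkcond (fun i => i \in _)) -!big_split /=.
  apply: eq_bigr => i _; rewrite !inE.
  by rewrite -rk; case: ltngtP.
pose F i : pred A := if i \in J then predT else
  if i \in F0 then [pred x | - x == x] else pred1 0.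
(* Erasing the values on [J'], which those on [J] determine, maps the skew functions bijectively
   onto [family F], whose size is a product. *)
pose r (u : {ffun I -> A}) := [ffun i => if i \in J' then 0 else u i].
have -> : ((#|I| - #|F0|) %/ 2 = #|J|)%N by rewrite cI; lia.
rewrite -(@card_in_imset _ _ r); last first.
  move=> u v; rewrite !inE => /forallP hu /forallP hv /ffunP e; apply/ffunP => i.
  have := e i; have := e (phi i); rewrite !ffunE !inE phiK.
  case: ltngtP => // _; rewrite (eqP (hu i)) (eqP (hv i)).
  by move/oppr_inj.
transitivity #|family F|.
  apply: eq_card => v; apply/imsetP/familyP => [[u] + -> i|h].
    rewrite inE => /forallP /(_ i) /eqP hu; rewrite ffunE /F !inE -rk.
    case: ltngtP => //; first by rewrite inE eqxx.
    by move=> er; have /eqP e : phi i == i by [rewrite -rk er]; rewrite inE -hu e.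
  exists [ffun i => if i \in J' then - v (phi i) else v i].
    rewrite inE; apply/forallP => i; rewrite !ffunE !inE phiK.
    case: ltngtP => //; first by rewrite opprK.
    move=> er; have e : phi i == i by [rewrite -rk er]; have := h i.
    by rewrite /F !inE e (eqP e) ltnn inE eq_sym.
  apply/ffunP => i; rewrite !ffunE !inE.
  have := h i; rewrite /F !inE -rk; case: ltngtP => // _.
  by rewrite inE => /eqP.
rewrite card_family foldrE big_map big_enum /=.
rewrite (eq_bigr (fun i => (if i \in J then #|A| else 1) *
   (if i \in F0 then #|[set x : A | - x == x]| else 1))%N); last first.
  move=> i _; rewrite /F; case: ifP => hJ.
    have -> : i \in F0 = false by move: hJ; rewrite !inE -rk; case: ltngtP.
    by rewrite muln1; apply: eq_card.
  case: ifP => _; last by rewrite card1.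
  by rewrite mul1n cardsE.
by rewrite big_split /= -!big_mkcond /= !prod_nat_const.
Qed.

Section Words.
Variables (n : nat) (A : finZmodType).
Implicit Types (u : {ffun 'I_n.+1 -> A}) (i j r : 'I_n.+1).

Definition rotate r u := [ffun i => u (i + r)].
(** For [j = n] this is negated reversal; the other [j] give its rotations. *)
Definition reflection j u := [ffun i => - u (j - i)].
Definition rotations u := [set rotate r u | r : 'I_n.+1].
Definition reflections u := [set reflection j u | j : 'I_n.+1].
Definition reflection_fix j := [set u | reflection j u == u].
Definition symmetric_words := [set u | [exists j, reflection j u == u]].

Lemma rotate_rotate r j u : rotate r (rotate j u) = rotate (r + j) u.
Proof. by apply/ffunP => i; rewrite !ffunE addrA. Qed.

Lemma reflection_rotate r j u : reflection j (rotate r u) = reflection (j + r) u.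
Proof. by apply/ffunP => i; rewrite !ffunE addrAC. Qed.

Lemma rotate_reflection r j u : rotate r (reflection j u) = reflection (j - r) u.
Proof. by apply/ffunP => i; rewrite !ffunE opprD addrA addrAC. Qed.

Lemma reflection_reflection r j u : reflection r (reflection j u) = rotate (j - r) u.
Proof. by apply/ffunP => i; rewrite !ffunE opprK opprB addrCA. Qed.

Lemma rotate0 u : rotate 0 u = u.
Proof. by apply/ffunP => i; rewrite !ffunE addr0. Qed.

Lemma reflectionK j : involutive (reflection j).
Proof. by move=> u; rewrite reflection_reflection subrr rotate0. Qed.

Lemma imset_reindex (T : finType) (F G : 'I_n.+1 -> T) h h' :
  cancel h' h -> (forall i, F i = G (h i)) ->
  [set F i | i : 'I_n.+1] = [set G i | i : 'I_n.+1].
Proof.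
move=> hK FG; apply/setP => x; apply/imsetP/imsetP => -[i _ ->].
  by exists (h i).
by exists (h' i); rewrite ?FG ?hK.
Qed.

Lemma rotations_rotate r u : rotations (rotate r u) = rotations u.
Proof. exact: (imset_reindex (addrNK r)) (rotate_rotate ^~ r ^~ u). Qed.

Lemma reflections_rotate r u : reflections (rotate r u) = reflections u.
Proof. exact: (imset_reindex (addrNK r)) (reflection_rotate r ^~ u). Qed.

Lemma rotations_reflection j u : rotations (reflection j u) = reflections u.
Proof. exact: (imset_reindex (subKr j)) (rotate_reflection ^~ j ^~ u). Qed.

Lemma reflections_reflection j u : reflections (reflection j u) = rotations u.
Proof. exact: (imset_reindex (subKr j)) (reflection_reflection ^~ j ^~ u). Qed.

(** A fixed point solves 2i = j modulo [n.+1], so 2i is [j] or [j + n.+1], and parity decides which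
    of them can occur. *)
Lemma card_subr_fix j :
  #|[set i | j - i == i]| =
  if odd n.+1 then 1%N else if odd j then 0%N else 2%N.
Proof.
have eqi i : (j - i == i) = ((i.*2 == j) || (i.*2 == j + n.+1))%N.
  have hi := ltn_ord i; have hj := ltn_ord j.
  rewrite subr_eq -val_eqE /= addnn eq_sym.
  have [lt|ge] := ltnP i.*2 n.+1; first by rewrite modn_small //; lia.
  rewrite -(subnK ge) modnDr modn_small; lia.
have hj := ltn_ord j.
case: ifP => oN.
  pose c := (if odd j then (j + n.+1)./2 else j./2)%N.
  have hc : (c < n.+1)%N by rewrite /c; case: ifP; lia.
  rewrite -(cards1 (Ordinal hc)); apply: eq_card => i.
  rewrite !inE eqi -val_eqE /= /c.
  case: ifP; lia.
case: ifP => oj.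
  apply/eqP; rewrite cards_eq0; apply/eqP/setP => i; rewrite !inE eqi; lia.
have h1 : (j./2 < n.+1)%N by lia.
have h2 : ((j + n.+1)./2 < n.+1)%N by lia.
have : #|[set Ordinal h1; Ordinal h2]| = 2%N.
  by rewrite cards2 -val_eqE /=; have -> : j./2 != (j + n.+1)./2 by lia.
move=> <-; apply: eq_card => i; rewrite !inE eqi -!val_eqE /=; lia.
Qed.

Lemma card_reflection_fix j :
  (#|reflection_fix j| =
   #|A| ^ ((n.+1 - #|[set i | (j - i)%R == i]|) %/ 2)
     * #|[set x : A | (- x)%R == x]| ^ #|[set i | (j - i)%R == i]|)%N.
Proof.
have := @card_skew_ffun _ A _ (subKr j); rewrite card_ord => <-.
apply: eq_card => u; rewrite !inE; apply/eqP/forallP => [e i|h].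
  by rewrite -{1}e ffunE subKr.
by apply/ffunP => i; rewrite ffunE (eqP (h i)) opprK.
Qed.

End Words.

(** The case j = 0 of the previous count: [delta] is the number of letters equal to their
    negative. *)
Lemma card_oppr_fix k : #|[set x : 'I_k.+1 | - x == x]| = delta k.+1.
Proof.
rewrite /delta -(card_subr_fix (0 : 'I_k.+1)).
by apply: eq_card => x; rewrite !inE sub0r.
Qed.

(** * Words of a shorter period *)

Section Periodic.
Variables (n m : nat) (A : finZmodType).
Hypothesis dvd_mn : (m.+1 %| n.+1)%N.

Definition residue (i : 'I_n.+1) : 'I_m.+1 := inZp i.
Definition periodic_word (v : {ffun 'I_m.+1 -> A}) : {ffun 'I_n.+1 -> A} :=
  [ffun i => v (residue i)].

Lemma residueD i j : residue (i + j) = residue i + residue j.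
Proof. by apply/val_inj; rewrite /= modn_dvdm // modnDm. Qed.

Lemma residueB i j : residue (i - j) = residue i - residue j.
Proof. by apply/eqP; rewrite eq_sym subr_eq -residueD subrK. Qed.

Lemma periodic_word_inj : injective periodic_word.
Proof.
move=> v w /ffunP e; apply/ffunP => i.
have hi : (i < n.+1)%N by apply: leq_trans (ltn_ord i) (dvdn_leq _ _).
have := e (Ordinal hi); rewrite !ffunE.
by have -> : residue (Ordinal hi) = i by apply/val_inj; rewrite /= modn_small.
Qed.

Lemma reflection_periodic j v :
  reflection j (periodic_word v) = periodic_word (reflection (residue j) v).
Proof. by apply/ffunP => i; rewrite !ffunE residueB. Qed.

(* Words with a shorter period are fixed by several reflections, so they are
   counted once, through their restriction to one period. *)
Lemma card_symmetric_words_le :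
  (#|symmetric_words n A| + \sum_(j < n.+1) #|reflection_fix A (residue j)| <=
   \sum_(j < n.+1) #|reflection_fix A j| + #|symmetric_words m A|)%N.
Proof.
pose M := [set periodic_word v | v : {ffun 'I_m.+1 -> A}].
have fixM j : #|reflection_fix A j :&: M| = #|reflection_fix A (residue j)|.
  rewrite -(card_imset _ periodic_word_inj); apply: eq_card => u.
  rewrite !inE; apply/andP/imsetP => [[/eqP e /imsetP[v _ ev]]|[v]].
    exists v => //; rewrite inE; apply/eqP/periodic_word_inj.
    by rewrite -reflection_periodic -ev.
  rewrite inE => /eqP e ->; rewrite reflection_periodic e eqxx; split=> //.
  exact: imset_f.
have sub : symmetric_words n A \subset
    (\bigcup_j (reflection_fix A j :\: M)) :|:
    [set periodic_word v | v in symmetric_words m A].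
  apply/subsetP => u; rewrite !inE => /existsP[j e].
  have [uM|uM] := boolP (u \in M); last first.
    by apply/orP; left; apply/bigcupP; exists j; rewrite // !inE uM.
  apply/orP; right; case/imsetP: uM e => v _ ->; rewrite reflection_periodic.
  rewrite (inj_eq periodic_word_inj) => e.
  by apply: imset_f; rewrite inE; apply/existsP; exists (residue j).
have := leq_trans (subset_leq_card sub) (leq_card_setU _ _).
rewrite (card_imset _ periodic_word_inj) => h.
have hU : (#|\bigcup_j (reflection_fix A j :\: M)| <=
    \sum_j #|reflection_fix A j :\: M|)%N.
  elim/big_ind2: _ => //; first by rewrite cards0.
  by move=> a x b y ha hb; apply: leq_trans (leq_card_setU _ _) (leq_add ha hb).
have -> : (\sum_(j < n.+1) #|reflection_fix A j| =
    \sum_j #|reflection_fix A j :\: M| + \sum_j #|reflection_fix A (residue j)|)%N.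
  rewrite -big_split /=; apply: eq_bigr => j _.
  by rewrite -fixM addnC cardsID.
rewrite [leqRHS]addnAC leq_add2r; exact: leq_trans h (leq_add hU (leqnn _)).
Qed.

End Periodic.

(** * Bounds on the number of symmetric words *)

Section Count.
Variable k : nat.
Local Notation A := 'I_k.+2.
Local Notation K := k.+2.

Lemma card_symmetric_odd n : odd n.+1 ->
  (#|symmetric_words n A| + n.+1 * delta K <=
   n.+1 * (K ^ (n %/ 2) * delta K) + delta K)%N.
Proof.
move=> on.
(* Period 1: every reflection fixes the same [delta K] constant words. *)
have := @card_symmetric_words_le n 0 A (dvd1n _).
have fix0 (j : 'I_1) : #|reflection_fix A j| = delta K.
  by rewrite card_reflection_fix card_subr_fix /= card_oppr_fix card_ord mul1n expn1.
have S0 : (#|symmetric_words 0 A| <= delta K)%N.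
  rewrite -(fix0 ord0); apply/subset_leq_card/subsetP => u.
  by rewrite !inE => /existsP[j]; rewrite (ord1 j).
rewrite (eq_bigr (fun=> delta K)) // sum_nat_const card_ord.
rewrite [X in (_ <= X + _)%N](eq_bigr (fun=> K ^ (n %/ 2) * delta K)%N); last first.
  move=> j _; rewrite card_reflection_fix card_subr_fix on card_oppr_fix card_ord.
  by rewrite subn1 expn1.
rewrite sum_nat_const card_ord; lia.
Qed.

Lemma sum_parity (a b h : nat) :
  (\sum_(j < h.*2) (if odd j then a else b) = h * (a + b))%N.
Proof.
elim: h => [|h IH]; first by rewrite big_ord0.
rewrite doubleS !big_ord_recr /= IH odd_double /= mulSn [RHS]addnC addnA.
by rewrite -!addnA (addnC a).
Qed.

(** An odd [j] fixes no index and an even [j] fixes two, whence the terms [K] and [delta K ^ 2].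
    Symmetric words of period dividing [m.+1] are bounded by the odd case. *)
Lemma card_symmetric_even n m : ~~ odd n.+1 -> odd m.+1 -> (m.+1 %| n.+1)%N ->
  (#|symmetric_words n A| + n.+1 * (K ^ (m %/ 2) * delta K) + m.+1 * delta K <=
   n.+1 %/ 2 * (K ^ (n.-1 %/ 2) * (delta K ^ 2 + K))
     + m.+1 * (K ^ (m %/ 2) * delta K) + delta K)%N.
Proof.
move=> on om dmn.
have := card_symmetric_words_le A dmn; have := card_symmetric_odd om.
rewrite (eq_bigr (fun=> K ^ (m %/ 2) * delta K)%N); last first.
  move=> j _; rewrite card_reflection_fix card_subr_fix om card_oppr_fix card_ord.
  by rewrite subn1 expn1.
rewrite sum_nat_const card_ord.
have -> : (\sum_(j < n.+1) #|reflection_fix A j| =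
    n.+1 %/ 2 * (K ^ (n.-1 %/ 2) * (delta K ^ 2 + K)))%N.
  rewrite (eq_bigr (fun j : 'I_n.+1 => if odd j then K ^ (n.-1 %/ 2) * K
      else K ^ (n.-1 %/ 2) * delta K ^ 2)%N); last first.
    move=> j _; rewrite card_reflection_fix card_subr_fix (negbTE on).
    rewrite card_oppr_fix card_ord.
    case: ifP => _; last by congr (_ ^ _ * _)%N; lia.
    rewrite muln1 -expnSr; congr (_ ^ _)%N; lia.
  have e : n.+1 = (n.+1 %/ 2).*2 by lia.
  rewrite -(big_mkord xpredT (fun j => if odd j then _ else _)) {1}e big_mkord.
  by rewrite sum_parity -mulnDr addnC.
lia.
Qed.
End Count.

(** * The set of difference words *)

Section Selection.
Variables n k : nat.
Local Notation K := k.+3.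
Local Notation word := {ffun 'I_n.+1 -> 'Z_K}.
Implicit Types (u : word) (x : 'Z_K).

(* Twice the residue of x in [1, k - 1], except that 0 counts as k / 2: then x
   and - x always add up to 2 * k and 1 is the unique lightest letter. *)
Definition letter_weight x : nat := if x == 0 then K else (x : nat).*2.
Definition weight u : nat := \sum_i letter_weight (u i).

(** At half weight, enumeration ranks choose between a rotation class and its mirror class; if the
    two coincide, neither is taken. *)
Definition selected u : bool :=
  (weight u < n.+1 * K)%N || (weight u == n.+1 * K)%N &&
  (enum_rank (rotations u) < enum_rank (reflections u))%N.

Lemma letter_weightN x : (letter_weight (- x) + letter_weight x = K * 2)%N.
Proof.
rewrite /letter_weight oppr_eq0; case: eqP => [_|/eqP x0]; first by lia.
have x_gt0 : (0 < x)%N by rewrite lt0n.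
have := ltn_ord x; rewrite [X in (_ < X)%N]/= => x_lt.
have -> : ((- x : 'Z_K) : nat) = (K - x)%N by rewrite /= modn_small //; lia.
by rewrite -doubleD subnK ?muln2 // ltnW.
Qed.

Lemma letter_weight1_lt x : x != 1 -> (letter_weight 1%R < letter_weight x)%N.
Proof.
have -> : letter_weight 1%R = 2%N by [].
rewrite /letter_weight; case: eqP => // /eqP; rewrite -!val_eqE /=.
by case: (nat_of_ord x) => [|[|y]].
Qed.

Lemma weight_rotate r u : weight (rotate r u) = weight u.
Proof.
rewrite /weight [RHS](reindex_inj (addIr r)).
by apply: eq_bigr => i _; rewrite ffunE.
Qed.

Lemma weight_reflection j u : (weight (reflection j u) + weight u = n.+1 * K * 2)%N.
Proof.
rewrite /weight [X in (_ + X)%N](reindex_inj (can_inj (subKr j))) -big_split /=.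
rewrite (eq_bigr (fun=> K * 2)%N); last by move=> i _; rewrite ffunE letter_weightN.
by rewrite sum_nat_const card_ord mulnA.
Qed.

Lemma selected_rotate r u : selected (rotate r u) = selected u.
Proof.
by rewrite /selected weight_rotate rotations_rotate reflections_rotate.
Qed.

Lemma selected_reflection j u : selected u -> ~~ selected (reflection j u).
Proof.
have := weight_reflection j u.
rewrite /selected rotations_reflection reflections_reflection.
set a := weight _; set b := weight _.
set r1 := nat_of_ord _; set r2 := nat_of_ord _.
lia.
Qed.

Lemma selected_or_reflection j u :
  u \notin symmetric_words n 'Z_K -> selected u || selected (reflection j u).
Proof.
move=> nsym.
(* Equal classes would make [u] one of its own reflections. *)
have : enum_rank (rotations u) != enum_rank (reflections u) :> nat.
  apply: contraNneq nsym => /val_inj/enum_rank_inj e.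
  have : u \in reflections u.
    by rewrite -e; apply/imsetP; exists 0; rewrite ?rotate0.
  by case/imsetP => i _ eu; rewrite inE; apply/existsP; exists i; rewrite -eu.
have := weight_reflection j u.
rewrite /selected rotations_reflection reflections_reflection.
set a := weight _; set b := weight _.
set r1 := nat_of_ord _; set r2 := nat_of_ord _.
lia.
Qed.

Lemma card_selected :
  (K ^ n.+1 <= #|[set u | selected u]| * 2 + #|symmetric_words n 'Z_K|)%N.
Proof.
set E := [set u | selected u].
have -> : (K ^ n.+1 = #|[set: word]|)%N by rewrite cardsT card_ffun !card_ord.
have sub : [set: word] \subset
    (E :|: [set reflection ord0 u | u in E]) :|: symmetric_words n 'Z_K.
  apply/subsetP => u _; rewrite in_setU orbC.
  have [//|/(selected_or_reflection ord0)/orP[h|h]] := boolP (u \in _) => /=.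
    by rewrite !inE h.
  rewrite in_setU orbC -{1}(reflectionK ord0 u) imset_f //; by rewrite inE.
apply: leq_trans (subset_leq_card sub) _.
apply: leq_trans (leq_card_setU _ _) _; rewrite leq_add2r.
apply: leq_trans (leq_card_setU _ _) _.
by rewrite (card_imset _ (can_inj (reflectionK ord0))) muln2 addnn.
Qed.

Lemma selected_lighter u v : selected u -> (weight v < weight u)%N -> selected v.
Proof.
rewrite /selected; set a := weight _; set b := weight _.
by move=> /orP[|/andP[]]; lia.
Qed.

(** * Lighter words, windows and their shift *)

Definition ones : word := [ffun=> 1].

Definition set_first1 u : word := [ffun i => if i == ord0 then 1 else u i].

Lemma weight_set_first1 u : u ord0 != 1 -> (weight (set_first1 u) < weight u)%N.
Proof.
move=> u0; rewrite /weight (bigD1 ord0) // [X in (_ < X)%N](bigD1 ord0) //=.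
rewrite ffunE eqxx; set s := (\sum_(i | _) _)%N; set s' := (\sum_(i | _) _)%N.
have -> : s = s' by apply: eq_bigr => i /negbTE i0; rewrite ffunE i0.
by rewrite ltn_add2r letter_weight1_lt.
Qed.

Lemma selected_ones : selected ones.
Proof.
suff : (weight ones < n.+1 * K)%N by rewrite /selected => ->.
rewrite /weight (eq_bigr (fun=> 2)%N); last by move=> i _; rewrite ffunE.
by rewrite sum_nat_const card_ord ltn_pmul2l.
Qed.

(* A pair (a, u) stands for the window of length n + 2 that starts with a and
   has difference word u; its first and last n + 1 letters are recorded by
   [state_head] and [state_tail]. *)
Notation state := ('Z_K * {u : word | selected u})%type.
Implicit Types z : state.

Definition state_head z : 'Z_K * {ffun 'I_n -> 'Z_K} :=
  (z.1, [ffun j => val z.2 (widen_ord (leqnSn n) j)]).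
Definition state_tail z : 'Z_K * {ffun 'I_n -> 'Z_K} :=
  (z.1 + val z.2 ord0, [ffun j => val z.2 (lift ord0 j)]).

Lemma selected_shift (w : {u : word | selected u}) :
  selected (rotate (inZp 1) (val w)).
Proof. by rewrite selected_rotate (valP w). Qed.

(** The window slides by one letter, and the difference dropped in front re-enters at the end. *)
Definition shift z : state :=
  (z.1 + val z.2 ord0, Sub (rotate (inZp 1) (val z.2)) (selected_shift z.2)).

Lemma shift_inj : injective shift.
Proof.
move=> [a u] [b v] h.
have eab : a + val u ord0 = b + val v ord0 by rewrite -[LHS]/(shift (a, u)).1 h.
have euv := congr1 (fun z : state => val z.2) h.
have e : val u = val v.
  apply/ffunP => i; move/ffunP: euv => /(_ (i - inZp 1)).
  by rewrite !ffunE subrK.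
rewrite e in eab; have -> : a = b by exact: addIr eab.
by congr pair; apply/val_inj.
Qed.

Lemma shift_tail z : state_tail z = state_head (shift z).
Proof.
congr pair; apply/ffunP => j; rewrite !ffunE; congr (val z.2 _).
apply/val_inj; rewrite /= modnDmr modn_small ?addn1 //.
by rewrite ltnS ltn_ord.
Qed.

(** * All windows are linked *)

Section Connected.
Variables (C : eqType) (cls : state -> C).
Hypothesis cls_tail : forall z z', state_tail z = state_tail z' -> cls z = cls z'.
Hypothesis cls_shift : forall z, cls (shift z) = cls z.

Let one_state a : state := (a, Sub ones selected_ones).

(** The shift adds 1 to the first letter of [one_state], and 1 generates ['Z_K]. *)
Lemma cls_ones a b : cls (one_state a) = cls (one_state b).
Proof.
suff h c : cls (one_state c) = cls (one_state 0) by rewrite !h.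
rewrite -(natr_Zp c); elim: (c : nat) => // q IH.
rewrite -IH -(cls_shift (one_state q%:R)); congr cls.
congr pair; first by rewrite /= ffunE mulrS addrC.
by apply/val_inj/ffunP => i; rewrite !ffunE.
Qed.

Lemma cls_rotate (r : nat) z : exists z',
  val z'.2 = rotate (inZp r) (val z.2) /\ cls z' = cls z.
Proof.
elim: r => [|r [z' [e c]]].
  exists z; split=> //; have -> : inZp 0 = 0 :> 'I_n.+1 by apply/val_inj.
  by rewrite rotate0.
exists (shift z'); split; last by rewrite cls_shift.
rewrite /= e rotate_rotate; congr rotate.
by apply/val_inj; rewrite /= modnDm.
Qed.

(** Induction on the weight: rotate a letter other than 1 to the front, then replace it by 1 without
    changing the tail. Below, [cls] becomes the cycle of a state. *)
Lemma cls_const z z' : cls z = cls z'.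
Proof.
suff h y : cls y = cls (one_state 0) by rewrite !h.
have [w] := ubnP (weight (val y.2)); elim: w y => // w IH y.
rewrite ltnS => lew.
have [e|] := eqVneq (val y.2) ones.
  have -> : y = one_state y.1.
    by case: y e {lew} => a u /= e; congr pair; apply/val_inj.
  exact: cls_ones.
move=> ne; have [i hi] : exists i, val y.2 i != 1.
  apply/existsP; apply: contraNT ne; rewrite negb_exists => /forallP h.
  by apply/eqP/ffunP => i; rewrite ffunE; apply/eqP; rewrite -[_ == _]negbK h.
have [x [ex <-]] := cls_rotate i y.
have x0 : val x.2 ord0 != 1.
  rewrite ex ffunE; have -> : ord0 + inZp i = i; last by [].
  by rewrite valZpK; exact: add0r.
have lt := weight_set_first1 x0.
have sel := selected_lighter (valP x.2) lt.
(* The first letter compensates for the new first difference, so that the second letter stays the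
   same. *)
pose x' : state := (x.1 + val x.2 ord0 - 1, Sub (set_first1 (val x.2)) sel).
rewrite -(IH x'); last first.
  by apply: leq_trans lt (leq_trans _ lew); rewrite ex weight_rotate.
apply: cls_tail; congr pair; first by rewrite /= ffunE eqxx subrK.
by apply/ffunP => j; rewrite !ffunE.
Qed.
End Connected.

(** * Reading the sequence off the single cycle *)

Lemma orientable_selected : exists (s : nat -> 'Z_K) (p : nat),
  orientable_sequence n.+2 s p /\ p = (K * #|[set u | selected u]|)%N.
Proof.
have [|sg [compat join sgs]] := @cycle_joining _ _ state_head state_tail
    (perm shift_inj).
  by move=> z; rewrite permE shift_tail.
have conn z z' : porbit sg z = porbit sg z'.
  by apply: (cls_const (cls := porbit sg)) => // y; rewrite -(sgs y) permE.
pose z0 : state := (0, Sub ones selected_ones).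
pose Z i := iter i sg z0.
have Zeq := iter_full_porbit (fun y => conn y z0).
pose s i := (Z i).1.
have next i : state_tail (Z i) = state_head (Z i.+1) by exact: compat.
(* Consecutive states overlap, so the difference at position [m] reaches the front after [m]
   steps. *)
have letter m i (hm : (m < n.+1)%N) :
    val (Z i).2 (Ordinal hm) = val (Z (i + m)%N).2 ord0.
  elim: m i hm => [|m IH] i hm.
    by rewrite addn0; congr (val (Z i).2 _); apply/val_inj.
  rewrite addnS -addSn -(IH i.+1 (ltnW hm)).
  have /(congr1 snd)/ffunP/(_ (Ordinal (hm : (m < n)%N))) := next i.
  rewrite !ffunE => e; rewrite (_ : Ordinal hm = lift ord0 (Ordinal (hm : (m < n)%N))).
    by rewrite e; congr (val (Z i.+1).2 _); apply/val_inj.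
  exact/val_inj.
have diff i (l : 'I_n.+1) : val (Z i).2 l = s (i + l).+1 - s (i + l)%N.
  have -> : s (i + l).+1 = s (i + l)%N + val (Z (i + l)%N).2 ord0.
    by have /(congr1 fst)/esym := next (i + l)%N.
  by rewrite addrAC subrr add0r -(letter l i (ltn_ord l)); congr (val (Z i).2 _);
    apply/val_inj.
have nthw i l : (l < n.+2)%N -> nth 0 (window s n.+2 i) l = s (i + l)%N.
  by move=> hl; rewrite (nth_map 0%N) ?size_iota // nth_iota.
have szw i : size (window s n.+2 i) = n.+2 by rewrite size_map size_iota.
(* The [n.+2] letters give the first letter and all differences, hence the state, and the single
   cycle visits each state once per turn. *)
have determined i j : (forall l, (l < n.+2)%N -> s (i + l)%N = s (j + l)%N) ->
    i = j %[mod #|{: state}|].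
  move=> h; apply/eqP; rewrite -Zeq; apply/eqP.
  have e1 : (Z i).1 = (Z j).1 by have := h 0 isT; rewrite !addn0.
  have e2 : (Z i).2 = (Z j).2.
    apply/val_inj/ffunP => l; have := ltn_ord l => ll.
    by rewrite !diff -!addnS !h // ltnW.
  by move: e1 e2; rewrite /Z; case: (iter i _ _) (iter j _ _) => [a u] [b v] /= -> ->.
have T0 : (0 < #|{: state}|)%N by apply/card_gt0P; exists z0.
have per i : s (i + #|{: state}|)%N = s i.
  by congr fst; apply/eqP; rewrite Zeq modnDr.
exists s, #|{: state}|; split; last first.
  by rewrite card_prod card_ord card_sig; congr muln; apply: eq_card => u; rewrite inE.
split; [split; [split=> // q q0 hq|]|] => [|i j e|i j e].
(* The windows at [q] and 0 agree, so the number of states divides [q]. *)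
- have /eqP : q = 0 %[mod #|{: state}|].
    by apply: determined => l _; rewrite addnC hq.
  by rewrite mod0n; exact: dvdn_leq.
- by apply: determined => l hl; rewrite -!nthw // e.
have mirror l : (l < n.+2)%N -> s (i + l)%N = s (j + (n.+1 - l))%N.
  by move=> hl; rewrite -nthw // e nth_rev szw // subSS nthw // ltnS leq_subr.
(* Reversing a window reverses and negates its difference word, but a selected word has no selected
   reflection. *)
suff eZ : val (Z i).2 = reflection ord_max (val (Z j).2).
  by have := selected_reflection ord_max (valP (Z j).2); rewrite -eZ (valP (Z i).2).
apply/ffunP => l; have := ltn_ord l => ll.
have el : ord_max - l = rev_ord l.
  apply/eqP; rewrite subr_eq -val_eqE /= subSS subnK // modn_small //.
rewrite ffunE el !diff opprB -addnS !mirror //= ?subSS; last by rewrite ltnW.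
congr (s _ - s _); lia.
Qed.
End Selection.

(** * Comparison with the closed formula *)

Lemma odd_partP n : (0 < n)%N -> odd (odd_part n) /\ (odd_part n %| n)%N.
Proof.
move=> n0; have [m cm e] := pfactor_coprime (isT : prime 2) n0.
have -> : odd_part n = m by rewrite /odd_part {1}e mulnK // expn_gt0.
by rewrite -coprime2n {1}e dvdn_mulr.
Qed.

Lemma s_le_card_selected n k :
  s_ k.+3 n <= #|[set u : {ffun 'I_n.+1 -> 'Z_k.+3} | selected u]|%:R.
Proof.
have := card_selected n k.
set e := #|[set u | _]|; set S := #|symmetric_words _ _|.
rewrite /s_; set d := delta _; set K := k.+3; set N := n.+1.
case: ifP => oN hE.
  have hS : (S + N * d <= N * (K ^ (n %/ 2) * d) + d)%N.
    exact: card_symmetric_odd.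
  have : (K ^ N + N * d <= e * 2 + (N * (K ^ (n %/ 2) * d) + d))%N.
    by rewrite -/K -/N in hE; move: hE hS; clearbody S e d K N; lia.
  rewrite -(ler_nat rat) !(natrD, natrM) subn1 /= -!natrX => h.
  move: h; rewrite !natrX; set x := _ ^+ _; set y := _ ^+ _ => h.
  lra.
have [om dm] : odd (odd_part N) /\ (odd_part N %| N)%N by exact: odd_partP.
(* The odd part of [N] is positive and becomes [m.+1], the shorter period. *)
move: om dm; case: (odd_part N) => // m om dm.
have hS : (S + N * (K ^ (m %/ 2) * d) + m.+1 * d <=
    N %/ 2 * (K ^ (n.-1 %/ 2) * (d ^ 2 + K))
      + m.+1 * (K ^ (m %/ 2) * d) + d)%N.
  exact: card_symmetric_even (negbT oN) om dm.
have : (K ^ N + N * (K ^ (m %/ 2) * d) + m.+1 * d <= e * 2 +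
   (N %/ 2 * (K ^ (n.-1 %/ 2) * (d ^ 2 + K)) + m.+1 * (K ^ (m %/ 2) * d) + d))%N.
  by rewrite -/K -/N in hE; move: hE hS; clearbody S e d K N; lia.
have -> : (N - 2 = n.-1)%N by rewrite /N; lia.
rewrite subn1 /=.
have hN : (N%:R : rat) = (N %/ 2)%:R * 2.
  by rewrite -natrM; congr _%:R; rewrite /N; lia.
rewrite -(ler_nat rat) !(natrD, natrM) !natrX hN => h.
lra.
Qed.

Theorem theorem5p8 (n k : nat) (hn : (3 <= n)%N) (hk : (3 <= k)%N) :
  exists (s : nat -> 'Z_k) (p : nat),
    orientable_sequence (n + 1) s p /\ k%:R * s_ k (n - 1) <= p%:R.
Proof.
(* From here [n] is one less than before: difference words have length [n.+1] and windows length
   [n.+2]. *)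
case: n hn => // n _; case: k hk => [|[|[|k]]] // _.
have [s [p [os ep]]] := orientable_selected n k.
exists s, p; rewrite addn1 subn1; split=> //.
by rewrite ep natrM ler_pM2l ?ltr0n // s_le_card_selected.
Qed.
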